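(* Assume the uncertain system defined by the interconnection of the augmented LTV system $G_a$ and the set of causal uncertainties $\mathbf{\Delta}$ is well-posed. Furthermore, assume each $\Delta \in \mathbf{\Delta}$ satisfies the time-domain IQCs defined by $\{ M_i \}_{i=1}^{m}\subset \mathbb{S}^{n_v+n_w}$. If there exist non-negative scalars $\{\lambda_i\}_{i=1}^m$ and a differentiable function $P:[0,T]\to \mathbb{S}^{n_x+1}$ such that $P(T)\succeq 0$ and, for all $t\in[0,T]$, \[ \begin{bmatrix} \dot{P} + A_a^\top P + P A_a & P B_a \\ B_a^\top P & 0 \end{bmatrix} + \begin{bmatrix} C_{e,a} & D_{ew} \end{bmatrix}^\top \begin{bmatrix} C_{e,a} & D_{ew} \end{bmatrix} + \sum_{i=1}^m \lambda_i \begin{bmatrix} C_{v,a} & D_{vw} \\ 0 & I \end{bmatrix}^\top M_i \begin{bmatrix} C_{v,a} & D_{vw} \\ 0 & I \end{bmatrix} \prec 0, \] then \[ \max_{\Delta \in \mathbf{\Delta}} \|\delta_e\|_{2,[0,T]} \le \left( \begin{bmatrix} 0\\ 1\end{bmatrix}^\top P(0) \begin{bmatrix} 0\\ 1 \end{bmatrix} \right)^{1/2}. \]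
   Context: Finite horizon $T<\infty$. The augmented LTV system $G_a$ with state $x_a(t)\in\mathbb{R}^{n_x+1}$ is $\dot{x}_a = A_a(t) x_a + B_a(t) w$, $v = C_{v,a}(t) x_a + D_{vw}(t) w$, $\delta_e = C_{e,a}(t) x_a + D_{ew}(t) w$, $x_a(0)=\begin{bmatrix}0\\1\end{bmatrix}$, where $A_a=\begin{bmatrix} A & 0\\ 0 & 0\end{bmatrix}$, $B_a=\begin{bmatrix} B\\0\end{bmatrix}$, $C_{v,a}=\begin{bmatrix} C_v & \bar v\end{bmatrix}$, $C_{e,a}=\begin{bmatrix} C_e & 0\end{bmatrix}$, with $(A,B,C_v,C_e,D_{vw},D_{ew})$ the time-varying matrices of the linearization of a nonlinear system along a nominal trajectory and $\bar v$ the nominal value of the signal $v$. The uncertainty is a causal operator $\Delta:\mathcal{L}_2^{n_v}[0,T]\to\mathcal{L}_2^{n_w}[0,T]$, $w=\Delta(v)$, in a set $\mathbf{\Delta}$. Well-posed means: for each $\Delta\in\mathbf{\Delta}$ there exist unique solutions $(x_a,v,w,\delta_e)$ in $\mathcal{L}_2[0,T]$ of the system equations with $x_a(0)=\begin{bmatrix}0\\1\end{bmatrix}$ and $w=\Delta(v)$. $\Delta$ satisfies the time-domain IQC defined by $M\in\mathbb{S}^{n_v+n_w}$ if $\int_0^T \begin{bmatrix} v\\ w\end{bmatrix}^\top M \begin{bmatrix} v\\ w\end{bmatrix} dt \ge 0$ for all $v\in\mathcal{L}_2^{n_v}[0,T]$ and $w=\Delta(v)$. $\|v\|_{2,[0,T]}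 = (\int_0^T v^\top v\,dt)^{1/2}$. *)

(* Defs.v *)
From HB Require Import structures.
From mathcomp Require Import all_boot all_order all_algebra.
From mathcomp Require Import all_classical all_reals all_analysis.
Set Implicit Arguments. Unset Strict Implicit. Unset Printing Implicit Defensive.
Import Order.TTheory GRing.Theory Num.Theory numFieldNormedType.Exports.
Local Open Scope classical_set_scope.
Local Open Scope ring_scope.

(* Signals on [0,T] are represented by functions R -> 'cV_n (only their values
   on [0,T] matter). *)

Definition itv0 (R : realType) (T : R) : set R := `[0, T].

Definition L2sig (R : realType) (n : nat) (T : R) (v : R -> 'cV[R]_n) : Prop :=
  forall i : 'I_n,
    measurable_fun (itv0 T) (fun t => v t i 0) /\
    (\int[@lebesgue_measure R]_(t in itv0 T) (((v t i 0) ^+ 2)%:E) < +oo)%E.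

Definition l2norm (R : realType) (n : nat) (T : R) (v : R -> 'cV[R]_n) : R :=
  Num.sqrt (Rintegral (@lebesgue_measure R) (itv0 T) (fun t => ((v t)^T *m v t) 0 0)).

Definition qform (R : realType) (n : nat) (M : 'M[R]_n) (u : 'cV[R]_n) : R :=
  (u^T *m M *m u) 0 0.

Definition symmetric_mx (R : realType) (n : nat) (M : 'M[R]_n) : Prop := M^T = M.

Definition negdef (R : realType) (n : nat) (M : 'M[R]_n) : Prop :=
  forall u : 'cV[R]_n, u != 0 -> qform M u < 0.
Definition psd (R : realType) (n : nat) (M : 'M[R]_n) : Prop :=
  forall u : 'cV[R]_n, 0 <= qform M u.

(* f : R -> R is differentiable on [0,T] (one-sided at the endpoints) with
   derivative df: the difference quotient converges within [0,T]. *)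
Definition has_deriv_on (R : realType) (T : R) (f df : R -> R) : Prop :=
  forall t, 0 <= t <= T ->
    (fun h => h^-1 * (f (t + h) - f t)) @ within [set h | 0 <= t + h <= T] (0^')
      --> df t.

Definition mx_has_deriv_on (R : realType) (n : nat) (T : R)
    (P dP : R -> 'M[R]_n) : Prop :=
  forall i j : 'I_n, has_deriv_on T (fun t => P t i j) (fun t => dP t i j).

Section Augmented.
Variables (R : realType) (nx nw nv ne : nat).
Variables (A : R -> 'M[R]_nx) (B : R -> 'M[R]_(nx, nw))
          (Cv : R -> 'M[R]_(nv, nx)) (Ce : R -> 'M[R]_(ne, nx))
          (Dvw : R -> 'M[R]_(nv, nw)) (Dew : R -> 'M[R]_(ne, nw))
          (vbar : R -> 'cV[R]_nv).

Definition Aa (t : R) : 'M[R]_(nx + 1) := block_mx (A t) 0 0 0.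
Definition Ba (t : R) : 'M[R]_(nx + 1, nw) := col_mx (B t) 0.
Definition Cva (t : R) : 'M[R]_(nv, nx + 1) := row_mx (Cv t) (vbar t).
Definition Cea (t : R) : 'M[R]_(ne, nx + 1) := row_mx (Ce t) 0.
Definition xa0 : 'cV[R]_(nx + 1) := col_mx 0 1.

(* (x_a, v, w, delta_e) solves the system equations of G_a with w = Delta(v),
   all signals in L2[0,T]; the state equation is understood in the
   Caratheodory sense x_a(t) = x_a(0) + int_0^t (A_a x_a + B_a w) ds. *)
Definition is_solution (T : R)
    (Delta : (R -> 'cV[R]_nv) -> (R -> 'cV[R]_nw))
    (xa : R -> 'cV[R]_(nx + 1)) (v : R -> 'cV[R]_nv) (w : R -> 'cV[R]_nw)
    (de : R -> 'cV[R]_ne) : Prop :=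
  [/\ L2sig T xa, L2sig T v, L2sig T w & L2sig T de] /\
      xa 0 = xa0 /\
      (forall i : 'I_(nx + 1),
          (@lebesgue_measure R).-integrable (itv0 T)
            (fun s => ((Aa s *m xa s + Ba s *m w s) i 0)%:E) /\
          forall t, 0 <= t <= T ->
            xa t i 0 = xa0 i 0 +
              Rintegral (@lebesgue_measure R) (itv0 t)
                (fun s => (Aa s *m xa s + Ba s *m w s) i 0)) /\
      (forall t, 0 <= t <= T -> v t = Cva t *m xa t + Dvw t *m w t) /\
      (forall t, 0 <= t <= T -> de t = Cea t *m xa t + Dew t *m w t) /\
      (forall t, 0 <= t <= T -> w t = Delta v t).

Definition well_posed (T : R)
    (Dset : set ((R -> 'cV[R]_nv) -> (R -> 'cV[R]_nw))) : Prop :=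
  forall Delta, Dset Delta ->
    (exists xa v w de, is_solution T Delta xa v w de) /\
    (forall xa v w de xa' v' w' de',
       is_solution T Delta xa v w de -> is_solution T Delta xa' v' w' de' ->
       forall t, 0 <= t <= T ->
         [/\ xa t = xa' t, v t = v' t, w t = w' t & de t = de' t]).

Definition Hv (t : R) : 'M[R]_(nv + nw, (nx + 1) + nw) :=
  block_mx (Cva t) (Dvw t) 0 1%:M.

Definition lmi_mx (m : nat) (P dP : R -> 'M[R]_(nx + 1)) (lam : 'I_m -> R)
    (M : 'I_m -> 'M[R]_(nv + nw)) (t : R) : 'M[R]_((nx + 1) + nw) :=
  block_mx (dP t + (Aa t)^T *m P t + P t *m Aa t) (P t *m Ba t)
           ((Ba t)^T *m P t) 0
  + (row_mx (Cea t) (Dew t))^T *m row_mx (Cea t) (Dew t)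
  + \sum_(i < m) lam i *: ((Hv t)^T *m M i *m Hv t).

End Augmented.

Definition causal_operator (R : realType) (nv nw : nat) (T : R)
    (Delta : (R -> 'cV[R]_nv) -> (R -> 'cV[R]_nw)) : Prop :=
  (forall v, L2sig T v -> L2sig T (Delta v)) /\
  (forall tau v1 v2, 0 <= tau <= T -> L2sig T v1 -> L2sig T v2 ->
     (forall t, 0 <= t <= tau -> v1 t = v2 t) ->
     forall t, 0 <= t <= tau -> Delta v1 t = Delta v2 t).

Definition satisfies_IQC (R : realType) (nv nw : nat) (T : R)
    (M : 'M[R]_(nv + nw)) (Delta : (R -> 'cV[R]_nv) -> (R -> 'cV[R]_nw)) : Prop :=
  forall v, L2sig T v ->
    0 <= Rintegral (@lebesgue_measure R) (itv0 T)
           (fun t => qform M (col_mx (v t) (Delta v t))).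

(* Main.v *)
(** The storage function V(t) = x_a(t)^T P(t) x_a(t) satisfies, by the matrix
    inequality evaluated at (x_a, w), V' <= -|delta_e|^2 - sum_i lam_i q_i almost
    everywhere, where q_i is the integrand of the i-th IQC. Integrating over
    [0,T] and using P(T) >= 0 together with the IQCs gives the bound.

    P is only differentiable, so P', hence V', need not be integrable and V need
    not be absolutely continuous. On the null set N where V' is not controlled,
    one still has |V(s) - V(t)| <= K_t \int_t^s H for s > t close to t, with one
    integrable H and a constant K_t depending on t. Such increments are absorbed
    by a monotone function psi of arbitrarily small total variation that grows,
    to the right of each point of N, faster than every multiple of \int H. *)
Require Import Defs.
From HB Require Import structures.
From mathcomp Require Import all_boot all_order all_algebra.
From mathcomp Require Import all_classical all_reals all_analysis.
From mathcomp Require Import measurable_realfun ring lra.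
Set Implicit Arguments. Unset Strict Implicit. Unset Printing Implicit Defensive.
Import Order.TTheory GRing.Theory Num.Theory numFieldNormedType.Exports.
Local Open Scope classical_set_scope.
Local Open Scope ring_scope.

(** * A comparison principle with an exceptional null set *)

(** Absolute continuity of the integral yields [d] such that sets of measure below [d] carry less
    than [e]; outer regularity then encloses a null cover of [N] in an open set that small. *)
Lemma open_superset_integral_lt (R : realType) (H : R -> R) (N : set R) (e : R) :
  (@lebesgue_measure R).-integrable setT (EFin \o H) ->
  (@lebesgue_measure R).-negligible N -> 0 < e ->
  exists O : set R, [/\ open O, N `<=` O &
    \int[@lebesgue_measure R]_(x in O) `|H x| < e].
Proof.
move=> iH [B [mB B0 NB]] e0.
have [d [d0 Hd]] := integral_normr_continuous iH e0.
have B0' : lebesgue_measure B = 0%E :> \bar R by exact: B0.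
have [|O [oO BO dO]] := lebesgue_regularity_outer mB _ d0.
  by have : (lebesgue_measure B < +oo :> \bar R)%E by rewrite B0'.
exists O; split => //; first exact: subset_trans BO.
apply: Hd; first exact: open_measurable.
apply: le_lt_trans dO.
rewrite -{1}(setDUK BO).
apply: le_trans (measureU2 _ _ _) _ => //.
  by apply: measurableD => //; exact: open_measurable.
by rewrite [X in (X + _ <= _)%E]B0' add0e.
Qed.

Lemma nneseries_indic_ge (R : realType) (O : nat -> set R) (n : nat) (a x : R) :
  0 <= a -> (forall k, (k < n)%N -> O k x) ->
  ((n%:R * a)%:E <= \sum_(k <oo) (a * \1_(O k) x)%:E)%E.
Proof.
move=> a0 Ox; apply: le_trans (nneseries_lim_ge n _) => /=; last first.
  by move=> k _ _; rewrite lee_fin mulr_ge0// indicE.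
rewrite sumEFin lee_fin big_mkord (eq_bigr (fun=> a)) => [|k _].
  by rewrite sumr_const card_ord mulr_natl.
by rewrite indicE mem_set ?mulr1//; exact: Ox.
Qed.

(* psi is the primitive of [sum_k H 1_(U_k)], where the open sets U_k contain N
   and [\int_(U_k) H < e / 2^(k+1)]: near a point of N all the first n sets
   contribute, so psi grows at least n times as fast as [\int H]. *)
Lemma null_dominating (R : realType) (H : R -> R) (N : set R) (e : R) :
  (@lebesgue_measure R).-integrable setT (EFin \o H) -> (forall x, 0 <= H x) ->
  (@lebesgue_measure R).-negligible N -> 0 < e ->
  exists psi : R -> R, [/\ {homo psi : x y / x <= y}, forall x, 0 <= psi x <= e &
    forall t, N t -> forall K, \forall s \near t^'+,
      K * \int[@lebesgue_measure R]_(x in `]t, s]) H x <= psi s - psi t].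
Proof.
move=> iH H0 N0 e0; set mu := @lebesgue_measure R.
have mH : measurable_fun setT H by apply/measurable_EFinP; case/integrableP : iH.
pose d k := e / (2 ^ k.+1)%:R.
have d0 k : 0 < d k by rewrite divr_gt0// ltr0n expn_gt0.
have /choice [U UP] : forall k, exists O : set R, [/\ open O, N `<=` O &
    \int[mu]_(x in O) `|H x| < d k] by move=> k; exact: open_superset_integral_lt.
have oO (k : nat) : open (U k) by case: (UP k).
have NO (k : nat) : N `<=` U k by case: (UP k).
have mO (k : nat) : measurable (U k) by exact: open_measurable.
pose h k x := (H x * \1_(U k) x)%:E.
have h0 k x : (0 <= h k x)%E by rewrite lee_fin mulr_ge0// indicE.
have mh k D : measurable D -> measurable_fun D (h k).
  move=> mD; apply/measurable_EFinP; apply: measurable_funM.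
    exact: measurable_funTS.
  by apply: measurable_indic.
(* The values are extended reals: at a point of [N] where [H] is positive the series is infinite.
   The bound [Phie] on the total integral still makes every primitive finite. *)
pose Phi x := (\sum_(k <oo) h k x)%E.
have Phi0 x : (0 <= Phi x)%E by apply: nneseries_ge0.
have mPhi D : measurable D -> measurable_fun D Phi.
  move=> mD; apply: ge0_emeasurable_sum => // k _.
  exact: mh.
have Phie : (\int[mu]_x Phi x <= e%:E)%E.
  rewrite /Phi integral_nneseries//; last by move=> k; exact: mh.
  apply: (@le_trans _ _ (\sum_(k <oo) (0 + (d k)%:E))%E); last first.
    apply: le_trans (epsilon_trick xpredT (fun=> lexx 0%E) (ltW e0)) _.
    by rewrite eseries0// add0e.
  apply: lee_nneseries => k _ => [_|]; first exact: integral_ge0.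
  rewrite add0e; case: (UP k) => _ _ /ltW; rewrite -lee_fin; apply: le_trans.
  rewrite /Rintegral fineK; last first.
    apply: integrable_fin_num; first exact: mO.
    exact: (@integrableS _ _ _ mu setT (U k) (abse \o (EFin \o H)) measurableT
      (mO k) (@subsetT _ _) (integrable_abse iH)).
  rewrite [leRHS]integral_mkcond le_eqVlt; apply/orP; left; apply/eqP.
  apply: eq_integral => x _; rewrite /h patchE indicE.
  by case: ifPn => xO /=; [rewrite ger0_norm ?mulr1|rewrite mulr0].
have iPhiS A B : measurable A -> measurable B -> A `<=` B ->
    (\int[mu]_(x in A) Phi x <= \int[mu]_(x in B) Phi x)%E.
  by move=> mA mB AB; apply: ge0_subset_integral => //; exact: mPhi.
have fPhi A : measurable A -> (\int[mu]_(x in A) Phi x)%E \is a fin_num.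
  move=> mA; rewrite ge0_fin_numE; last exact: integral_ge0.
  apply: le_lt_trans (ltry e); apply: le_trans Phie.
  exact: iPhiS.
have mi (t : R) : measurable (`]-oo, t]%classic : set R) by exact: measurable_itv.
exists (fun t => fine (\int[mu]_(x in `]-oo, t]) Phi x)%E); split.
- move=> s t st; apply: fine_le; [exact: fPhi|exact: fPhi|].
  apply: iPhiS => // x /=; rewrite !in_itv/= => /le_trans; exact.
- move=> t; rewrite fine_ge0 ?integral_ge0//= -lee_fin fineK ?fPhi//.
  by apply: le_trans Phie; exact: iPhiS.
move=> t Nt K.
(* Only finitely many open sets are needed to beat [K]: for [s] close to [t], the first [n] of them
   all contain []t, s]], so that [Phi] is at least [n * H] there. *)
pose n := (Num.trunc `|K|).+1.
have Kn : K <= n%:R.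
  by rewrite (le_trans (ler_norm K))// ltW// truncnS_gt.
have : \forall s \near t^'+, forall k, (k < n)%N -> `]t, s]%classic `<=` U k.
  elim: n {Kn} => [|n ih]; first by near=> s.
  have [r /= r0 rO] : exists2 r, 0 < r & ball t r `<=` U n.
    by have /nbhs_ballP[r r0 rO] := open_nbhs_nbhs (conj (oO n) (NO n _ Nt)); exists r.
  near=> s => k; rewrite ltnS leq_eqVlt => /orP[/eqP -> x|kn]; last first.
    have : forall k, (k < n)%N -> `]t, s]%classic `<=` U k by near: s.
    exact.
  rewrite /= in_itv/= => /andP[tx xs]; apply: rO => /=.
  rewrite /ball/= ltr0_norm ?subr_lt0// opprB ltrBlDl.
  apply: le_lt_trans xs _.
  by near: s; apply: nbhs_right_lt; rewrite ltrDl.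
apply: filterS2 (nbhs_right_gt t) => s ts sO.
have -> : `]-oo, s]%classic = `]-oo, t]%classic `|` `]t, s]%classic.
  by rewrite -itv_bndbnd_setU// bnd_simp ltW.
rewrite ge0_integral_setU//=; [|exact: mPhi (measurableU _ _ (mi _) (measurable_itv _))|].
2:{ apply/disj_setPS => x [] /=; rewrite !in_itv/= => xt /andP[+ _].
    by rewrite ltNge xt. }
rewrite fineD ?fPhi// addrC addKr.
have iHI : mu.-integrable `]t, s] (EFin \o H) by exact: integrableS iH.
apply: (@le_trans _ _ (n%:R * \int[mu]_(x in `]t, s]) H x)).
  by rewrite ler_wpM2r// Rintegral_ge0.
rewrite -RintegralZl// fine_le ?fPhi//.
  apply: integrable_fin_num => //.
  by apply: (integrableZl _ _ iHI).
apply: ge0_le_integral => //=.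
- by move=> x _; rewrite lee_fin mulr_ge0.
- apply/measurable_EFinP; apply: measurable_funM => //.
  exact: measurable_funTS.
- exact: mPhi.
- move=> x xI; apply: nneseries_indic_ge => // k kn.
  exact: sO xI.
Unshelve. all: by end_near. Qed.

(* The set of t with [W t <= W 0 + (psi t - psi 0) + d * t] contains its supremum
   by left continuity of W and monotonicity of psi, and it extends to the right of
   each of its points t < T. *)
Lemma le_of_right_increments (R : realType) (W H : R -> R) (N : set R) (T : R) :
  (@lebesgue_measure R).-integrable setT (EFin \o H) -> (forall x, 0 <= H x) ->
  (@lebesgue_measure R).-negligible N -> 0 < T ->
  (forall t, 0 < t <= T -> W s @[s --> t^'-] --> W t) ->
  (forall t, 0 <= t < T -> N t -> exists K, \forall s \near t^'+,
    W s - W t <= K * \int[@lebesgue_measure R]_(x in `]t, s]) H x) ->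
  (forall t, 0 <= t < T -> ~ N t -> forall e, 0 < e -> \forall s \near t^'+,
    W s - W t <= e * (s - t)) ->
  W T <= W 0.
Proof.
move=> iH H0 N0 T0 Wl WN Wd; apply/ler_addgt0Pr => e e0.
have T1 : 0 < 1 + T by rewrite addr_gt0.
(* The total slack on [[0, T]] is at most [d], from the variation of [psi], plus [d * T], from the
   linear term; this choice makes the sum equal to [e]. *)
pose d := e / (1 + T).
have d0 : 0 < d by rewrite divr_gt0.
have [psi [psi_homo psid psiN]] := null_dominating iH H0 N0 d0.
pose S := [set t | 0 <= t <= T /\ W t <= W 0 + (psi t - psi 0) + d * t].
have S0 : S 0.
  by split; [rewrite lexx ltW|rewrite subrr mulr0 !addr0].
have ubS : ubound S T by move=> t [/andP[]].
have supS : has_sup S by split; [exists 0|exists T].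
set s := sup S.
have s0 : 0 <= s by apply: ub_le_sup => //; exists T.
have sT : s <= T by apply: ge_sup => //; exists 0.
have Ss : S s.
  split; first by rewrite s0.
  rewrite leNgt; apply/negP => cW.
  have {}s0 : 0 < s.
    rewrite lt_neqAle s0 andbT; apply/eqP => s_eq; move: cW.
    by rewrite -s_eq subrr mulr0 !addr0 ltxx.
  have /cvgr_gt/(_ _ cW) : W u @[u --> s^'-] --> W s by apply: Wl; rewrite s0 sT.
  move=> /nbhs_ballP[r /= r0 rW].
  have [u Su us] := sup_adherent r0 supS.
  have uls : u <= s by apply: ub_le_sup => //; exists T.
  have uLs : u < s.
    rewrite lt_neqAle uls andbT; apply/eqP => u_eq; case: Su => _.
    by rewrite u_eq leNgt cW.
  have := rW u; rewrite /ball/= ger0_norm ?subr_ge0// ltrBlDr -ltrBlDl.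
  move=> /(_ us uLs); apply/negP; rewrite -leNgt.
  case: Su => _ /le_trans; apply.
  by rewrite lerD ?ler_wpM2l ?(ltW d0)// lerD2l lerD2r psi_homo.
have [sLT|] := ltP s T; last first.
  move=> Ts; have -> : T = s by apply/eqP; rewrite eq_le Ts.
  case: Ss => _ /le_trans; apply.
  have /andP[_ psis] := psid s; have /andP[psi0 _] := psid 0.
  have -> : e = d + d * T by rewrite -{1}(mulr1 d) -mulrDr mulfVK ?gt_eqF.
  rewrite -addrA lerD2l lerD ?ler_wpM2l ?(ltW d0)//.
  by rewrite lerBlDr (le_trans psis)// lerDl.
(* On [N] the growth of [psi] pays for the increment; off [N] the linear term does, and [psi] does
   no harm by monotonicity. *)
have step : \forall r \near s^'+, W r - W s <= (psi r - psi s) + d * (r - s).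
  have sI : 0 <= s < T by rewrite s0.
  have [Ns|nNs] := pselect (N s).
    have [K WK] := WN s sI Ns; have := psiN s Ns K.
    apply: filterS3 (nbhs_right_gt s) WK => r sr h1 h2.
    apply: le_trans h1 (le_trans h2 _).
    by rewrite lerDl mulr_ge0 ?subr_ge0 ?ltW.
  apply: filterS2 (nbhs_right_gt s) (Wd s sI nNs d d0) => r sr /le_trans; apply.
  by rewrite lerDr subr_ge0 psi_homo// ltW.
have [r [sr rT Wr]] : exists r, [/\ s < r, r < T &
    W r - W s <= (psi r - psi s) + d * (r - s)].
  apply: (@filter_ex _ (s^'+)).
  by apply: filterS3 (nbhs_right_gt s) (nbhs_right_lt sLT) step => r; split.
suff : r <= s by rewrite leNgt sr.
apply: ub_le_sup; first by exists T.
split; first by rewrite (le_trans s0 (ltW sr)) ltW.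
case: Ss => _ Ws; lra.
Qed.

(** * Functions differentiable on a segment and primitives *)

(** Near [t] the difference quotient is within 1 of [df t]. The constant depends on [t], since no
    bound on [df] is assumed. *)
Lemma has_deriv_on_lipschitz (R : realType) (T : R) (f df : R -> R) (t : R) :
  has_deriv_on T f df -> 0 <= t <= T ->
  \forall s \near t, 0 <= s <= T -> `|f s - f t| <= (`|df t| + 1) * `|s - t|.
Proof.
move=> fdf tT; have /cvgrPdist_le/(_ 1 ltr01) := fdf t tT.
rewrite near_withinE /dnbhs near_withinE => /nbhs_ballP[r /= r0 rP].
near=> s => sT; have [->|st] := eqVneq s t; first by rewrite !subrr !normr0 mulr0.
have sr : ball 0 r (s - t).
  by rewrite /ball/= sub0r normrN distrC; near: s; exact: nbhsx_ballx.
have {rP} := rP (s - t) sr; rewrite subr_eq0 => /(_ st).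
rewrite /= addrC subrK => /(_ sT) h.
rewrite -ler_pdivrMr ?normr_gt0 ?subr_eq0// -normfV -normrM mulrC.
rewrite -lerBlDl; apply: le_trans h; rewrite distrC.
exact: lerB_dist.
Unshelve. all: by end_near. Qed.

Lemma has_deriv_on_cvg_left (R : realType) (T : R) (f df : R -> R) (t : R) :
  has_deriv_on T f df -> 0 < t <= T -> f s @[s --> t^'-] --> f t.
Proof.
move=> fdf /andP[t0 tT]; apply/cvgrPdist_le => e e0.
have K0 : 0 < `|df t| + 1 by rewrite ltr_wpDl.
have := has_deriv_on_lipschitz fdf (t := t); rewrite (ltW t0) tT => /(_ isT) fL.
near=> s.
have st : s < t by near: s; exact: nbhs_left_lt.
have s0 : 0 <= s by near: s; apply: nbhs_left_ge.
rewrite distrC.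
have h : `|f s - f t| <= (`|df t| + 1) * `|s - t|.
  have : 0 <= s <= T -> `|f s - f t| <= (`|df t| + 1) * `|s - t|.
    by near: s; exact: cvg_within fL.
  by apply; rewrite s0 (le_trans (ltW st)).
apply: le_trans h _; rewrite -ler_pdivlMl// mulrC distrC ger0_norm ?subr_ge0 ?ltW//.
rewrite ltrBlDl -ltrBlDr.
by near: s; apply: nbhs_left_gt; rewrite ltrBlDr ltrDl divr_gt0.
Unshelve. all: by end_near. Qed.

(** At an interior point the constraint [0 <= t + h <= T] holds for all small [h], so the restricted
    limit is the ordinary two-sided one. *)
Lemma has_deriv_on_is_derive (R : realType) (T : R) (f df : R -> R) (t : R) :
  has_deriv_on T f df -> 0 < t < T -> is_derive t 1 f (df t).
Proof.
move=> fdf /andP[t0 tT].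
have H : h^-1 *: ((f \o shift t) (h *: 1) - f t) @[h --> 0^'] --> df t.
  have /cvgrPdist_le ft : h^-1 * (f (t + h) - f t)
      @[h --> within [set h | 0 <= t + h <= T] 0^'] --> df t.
    by apply: fdf; rewrite !ltW.
  apply/cvgrPdist_le => e e0.
  have {ft} := ft e e0.
  rewrite near_withinE => ft.
  near=> h.
  rewrite /= /GRing.scale/= mulr1 (addrC h).
  have : 0 <= t + h <= T -> `|df t - h^-1 * (f (t + h) - f t)| <= e by near: h.
  apply.
  have ht : `|h| <= t by near: h; exact: dnbhs0_le.
  have hT : `|h| <= T - t by near: h; apply: dnbhs0_le; rewrite subr_gt0.
  move: ht hT; rewrite !ler_norml => /andP[h1 _] /andP[_ h2].
  by apply/andP; split; lra.
split; first by apply/cvg_ex; exists (df t).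
by apply/cvg_lim; [exact: Rhausdorff|].
Unshelve. all: by end_near. Qed.

Lemma is_derive_le0_right (R : realType) (f : R -> R) (t d : R) :
  is_derive t 1 f d -> d <= 0 -> forall e, 0 < e ->
  \forall s \near t^'+, f s - f t <= e * (s - t).
Proof.
move=> [fd fE] d0 e e0.
have H : h^-1 *: ((f \o shift t) (h *: 1) - f t) @[h --> 0^'] --> d.
  by rewrite -fE; exact: fd.
have /cvgrPdist_le/(_ e e0) := H.
rewrite /dnbhs near_withinE => /nbhs_ballP[r /= r0 rP].
near=> s.
have st : t < s by near: s; exact: nbhs_right_gt.
have sr : ball 0 r (s - t).
  rewrite /ball/= sub0r normrN gtr0_norm ?subr_gt0// ltrBlDl.
  by near: s; apply: nbhs_right_lt; rewrite ltrDl.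
have {rP} := rP (s - t) sr; rewrite subr_eq0 gt_eqF// => /(_ isT).
rewrite /GRing.scale/= mulr1 subrK mulrC => h.
rewrite -ler_pdivrMr ?subr_gt0//.
by move: h; rewrite ler_norml => /andP[h1 h2]; lra.
Unshelve. all: by end_near. Qed.

Section primitive.
Context {R : realType}.
Notation mu := (@lebesgue_measure R).
Implicit Types (f : R -> R) (t s : R).

Lemma Rintegral_itv0B f t s : mu.-integrable setT (EFin \o f) ->
  0 <= t -> t <= s ->
  \int[mu]_(x in `[0, s]) f x - \int[mu]_(x in `[0, t]) f x =
  \int[mu]_(x in `]t, s]) f x.
Proof.
move=> fi t0 ts; apply: Rintegral_itvB; rewrite ?bnd_simp//.
exact: integrableS fi.
Qed.

Lemma Rintegral_itv0_cvg_left f t : mu.-integrable setT (EFin \o f) ->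
  0 < t -> \int[mu]_(x in `[0, s]) f x @[s --> t^'-] --> \int[mu]_(x in `[0, t]) f x.
Proof.
move=> fi t0.
have ft : mu.-integrable `[0, t] (EFin \o f) by exact: integrableS fi.
have := parameterized_integral_continuous (ltW t0) ft.
by move=> /(continuous_within_itvP _ t0)[].
Qed.

Lemma Rintegral_itv0_is_derive f t : mu.-integrable setT (EFin \o f) ->
  0 < t -> lebesgue_pt f t ->
  is_derive t 1 (fun s => \int[mu]_(x in `[0, s]) f x) (f t).
Proof.
move=> fi t0 ft.
(* The endpoint [t + 1] is an arbitrary choice beyond [t]. *)
have [] := @FTC1_lebesgue_pt _ f (BLeft 0) t (t + 1) _ _ _ ft; rewrite ?ltrDl ?bnd_simp//.
  exact: integrableS fi.
by move=> ? <-; rewrite derive1E; split.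
Qed.

End primitive.

(** * Increments to the right of a point, dominated by the integral of [H] *)

Section right_dominated.
Context {R : realType}.
Notation mu := (@lebesgue_measure R).
Variables (H : R -> R) (t : R).
Hypotheses (iH : mu.-integrable setT (EFin \o H)) (H0 : forall x, 0 <= H x).

(* Unlike absolute continuity, this local property holds for every function
   differentiable at t once [1 <= H]; it is stable under sums and products. *)
Definition right_dominated (f : R -> R) := exists2 K, 0 <= K &
  \forall s \near t^'+, `|f s - f t| <= K * \int[mu]_(x in `]t, s]) H x.

Lemma right_dominated_cst c : right_dominated (fun=> c).
Proof. by exists 0 => //; near=> s; rewrite subrr normr0 mul0r.
Unshelve. all: by end_near. Qed.

Lemma right_dominatedD f g : right_dominated f -> right_dominated g ->
  right_dominated (fun s => f s + g s).
Proof.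
move=> [K K0 fK] [L L0 gL]; exists (K + L); first exact: addr_ge0.
apply: filterS2 fK gL => s fK gL; rewrite mulrDl opprD addrACA.
by rewrite (le_trans (ler_normD _ _))// lerD.
Qed.

Lemma right_dominatedN f : right_dominated f -> right_dominated (fun s => - f s).
Proof.
by move=> [K K0 fK]; exists K => //; apply: filterS fK => s; rewrite -opprD normrN.
Qed.

Lemma right_dominatedB f g : right_dominated f -> right_dominated g ->
  right_dominated (fun s => f s - g s).
Proof. by move=> fd gd; apply: right_dominatedD fd _; exact: right_dominatedN. Qed.

(** The product increment splits as [f s * (g s - g t) + (f s - f t) * g t]. The factor [f s] is
    bounded because the integral of [H] over []t, s]] never exceeds its total integral [C]. *)
Lemma right_dominatedM f g : right_dominated f -> right_dominated g ->
  right_dominated (fun s => f s * g s).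
Proof.
move=> [K K0 fK] [L L0 gL]; set C := \int[mu]_x H x.
have C0 : 0 <= C by exact: Rintegral_ge0.
exists ((`|f t| + K * C) * L + K * `|g t|).
  by rewrite addr_ge0// mulr_ge0// addr_ge0// mulr_ge0.
apply: filterS2 fK gL => s; set I := \int[mu]_(x in `]t, s]) H x => fK gL.
have I0 : 0 <= I by exact: Rintegral_ge0.
have IC : I <= C.
  rewrite /I /C /Rintegral fine_le//.
  - by apply: integrable_fin_num => //; exact: integrableS iH.
  - exact: integrable_fin_num.
  - apply: ge0_subset_integral => //.
    + by case/integrableP : iH.
    + by move=> x _; rewrite lee_fin.
have fs : `|f s| <= `|f t| + K * C.
  rewrite -(subrK (f t) (f s)) addrC (le_trans (ler_normD _ _))// lerD2l.
  by rewrite (le_trans fK)// ler_wpM2l.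
have -> : f s * g s - f t * g t = f s * (g s - g t) + (f s - f t) * g t by ring.
rewrite (le_trans (ler_normD _ _))// !normrM.
rewrite mulrDl -(mulrA _ L) (mulrAC K) lerD//; first exact: ler_pM.
exact: ler_wpM2r.
Qed.

Lemma right_dominated_sum n (f : 'I_n -> R -> R) :
  (forall i, right_dominated (f i)) ->
  right_dominated (fun s => \sum_(i < n) f i s).
Proof.
move=> fd; elim: n f fd => [|n ih] f fd.
  under eq_fun do rewrite big_ord0.
  exact: right_dominated_cst.
under eq_fun do rewrite big_ord_recl.
by apply: right_dominatedD => //; exact: ih.
Qed.

Lemma right_dominated_primitive (f : R -> R) : 0 <= t ->
  mu.-integrable setT (EFin \o f) -> (forall x, `|f x| <= H x) ->
  right_dominated (fun s => \int[mu]_(x in `[0, s]) f x).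
Proof.
move=> t0 fi fH; exists 1 => //.
apply: filterS (nbhs_right_gt t) => s ts.
rewrite mul1r (Rintegral_itv0B fi t0 (ltW ts)).
have fS : mu.-integrable `]t, s] (EFin \o f) by exact: integrableS fi.
apply: (@le_trans _ _ (\int[mu]_(x in `]t, s]) `|f x|)).
  exact: le_normr_Rintegral.
apply: le_Rintegral => //.
- exact: (integrable_norm fS).
- exact: integrableS iH.
Qed.

(** The local Lipschitz bound is proportional to [s - t], which is the integral of 1 over []t, s]]
    and hence at most that of [H]. *)
Lemma right_dominated_deriv (T : R) f df : has_deriv_on T f df -> 0 <= t < T ->
  (forall x, 0 <= x <= T -> 1 <= H x) -> right_dominated f.
Proof.
move=> fdf /andP[t0 tT] H1; exists (`|df t| + 1); first by rewrite addr_ge0.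
have := has_deriv_on_lipschitz fdf (t := t); rewrite t0 (ltW tT) => /(_ isT) fL.
near=> s.
have ts : t < s by near: s; exact: nbhs_right_gt.
have sT : s <= T by near: s; exact: nbhs_right_le.
have h : `|f s - f t| <= (`|df t| + 1) * `|s - t|.
  have : 0 <= s <= T -> `|f s - f t| <= (`|df t| + 1) * `|s - t|.
    by near: s; exact: cvg_within fL.
  by apply; rewrite sT (le_trans t0)// ltW.
apply: le_trans h _; rewrite ler_wpM2l ?addr_ge0//.
rewrite gtr0_norm ?subr_gt0//.
have ts1 : \int[mu]_(x in `]t, s]) (1 : R) = s - t.
  rewrite Rintegral_cst//= lebesgue_measure_itv/= lte_fin ts mul1r -EFinB/=.
  by [].
rewrite -ts1; apply: le_Rintegral => //.
- apply: measurable_bounded_integrable => //.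
    by rewrite /= lebesgue_measure_itv/= lte_fin ts -EFinB ltry.
  by exists 1; split => // M M1 x _; rewrite /= normr1 ltW.
- exact: integrableS iH.
- move=> x; rewrite /= in_itv/= => /andP[tx xs]; apply: H1.
  by rewrite (le_trans t0 (ltW tx)) (le_trans xs).
Unshelve. all: by end_near. Qed.

End right_dominated.

(** * Growth of a quadratic form along a trajectory *)

Lemma bilinear_formE (R : realType) (n : nat) (u v : 'cV[R]_n) (M : 'M[R]_n) :
  (u^T *m M *m v) 0 0 = \sum_j \sum_i u i 0 * M i j * v j 0.
Proof.
rewrite mxE; apply: eq_bigr => j _; rewrite mxE mulr_suml.
by apply: eq_bigr => i _; rewrite mxE.
Qed.

Lemma is_derive_quadratic (R : realType) (n : nat) (x : 'I_n -> R -> R)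
    (P : R -> 'M[R]_n) (dx : 'cV[R]_n) (dP : 'M[R]_n) (t : R) :
  (forall i, is_derive t 1 (x i) (dx i 0)) ->
  (forall i j, is_derive t 1 (fun s => P s i j) (dP i j)) ->
  let u := \col_i x i t in
  is_derive t 1 (fun s => \sum_j \sum_i x i s * P s i j * x j s)
    ((dx^T *m P t *m u + u^T *m dP *m u + u^T *m P t *m dx) 0 0).
Proof.
move=> xd Pd u.
have sumE (h : 'I_n -> R -> R) : (fun s => \sum_i h i s) = \sum_i h i.
  by apply/funext => s; rewrite fct_sumE.
(* Once written as a sum of products of functions, the expression is differentiated by instance
   inference; [is_derive_eq] leaves only an algebraic identity between entries. *)
rewrite (_ : (fun s => _) =
  \sum_j \sum_i (x i * (fun s => P s i j) * x j : R -> R)); last first.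
  by rewrite -sumE; apply/funext => s; apply: eq_bigr => j _; rewrite fct_sumE.
apply: is_derive_eq.
have mxD3 (a b c : 'M[R]_1) : (a + b + c) 0 0 = a 0 0 + b 0 0 + c 0 0.
  by rewrite !mxE.
rewrite mxD3 !bilinear_formE -!big_split/=; apply: eq_bigr => j _.
rewrite -!big_split/=; apply: eq_bigr => i _.
by rewrite !mxE /GRing.scale/= mulrfctE; ring.
Qed.

(** This replaces the fundamental theorem of calculus for the storage function: the comparison
    principle is applied to the quadratic form minus the primitive of [g], whose derivative is
    nonpositive almost everywhere. *)
Lemma qform_growth (R : realType) (n : nat) (T : R) (X F : R -> 'cV[R]_n)
    (P dP : R -> 'M[R]_n) (g : R -> R) :
  0 < T ->
  (forall i, (@lebesgue_measure R).-integrable `[0, T] (fun s => (F s i 0)%:E)) ->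
  (forall i t, 0 <= t <= T ->
    X t i 0 = X 0 i 0 + \int[@lebesgue_measure R]_(s in `[0, t]) F s i 0) ->
  mx_has_deriv_on T P dP ->
  (@lebesgue_measure R).-integrable `[0, T] (EFin \o g) ->
  (forall t, 0 <= t <= T ->
    ((F t)^T *m P t *m X t + (X t)^T *m dP t *m X t + (X t)^T *m P t *m F t) 0 0
      <= g t) ->
  qform (P T) (X T) - qform (P 0) (X 0) <=
    \int[@lebesgue_measure R]_(s in `[0, T]) g s.
Proof.
move=> T0 Fi XF PdP gi Fg; set mu := @lebesgue_measure R.
(* Extension by zero outside [[0, T]] gives integrability on the whole line, as the comparison
   principle and the facts on primitives require. *)
pose f i : R -> R := (fun s => F s i 0) \_ `[0, T].
pose g0 : R -> R := g \_ `[0, T].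
have fi i : mu.-integrable setT (EFin \o f i).
  by have := Fi i; rewrite integrable_mkcond//= restrict_EFin.
have g0i : mu.-integrable setT (EFin \o g0).
  by have := gi; rewrite integrable_mkcond//= restrict_EFin.
have restrE (h : R -> R) t : t <= T ->
    \int[mu]_(s in `[0, t]) (h \_ `[0, T]) s = \int[mu]_(s in `[0, t]) h s.
  move=> tT; apply: eq_Rintegral => s; rewrite inE/= in_itv/= => /andP[s0 st].
  by rewrite patchE mem_set//= in_itv/= s0 (le_trans st).
(* One dominating function for all ingredients of [W]: the indicator handles the entries of [P], the
   other terms the primitives of [f i] and [g0]. *)
pose H : R -> R := fun x => \1_`[0, T] x + (\sum_i `|f i x| + `|g0 x|).
have fH i x : `|f i x| <= H x.
  rewrite /H (bigD1 i)//=; set S := \sum_(_ | _) _.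
  have S0 : 0 <= S by exact: sumr_ge0.
  have I0 : 0 <= \1_`[0, T] x :> R by rewrite indicE.
  have := normr_ge0 (g0 x); lra.
have gH x : `|g0 x| <= H x.
  by rewrite /H addrA lerDr addr_ge0 ?indicE//; apply: sumr_ge0.
have H0 x : 0 <= H x by apply: le_trans (gH x).
have H1 x : 0 <= x <= T -> 1 <= H x.
  move=> xT; rewrite /H indicE mem_set//= lerDl addr_ge0//.
  by apply: sumr_ge0.
have iH : mu.-integrable setT (EFin \o H).
  rewrite /H /comp/=.
  under eq_fun do rewrite !EFinD -sumEFin.
  apply: integrableD => //; first exact: integrable_indic_itv.
  apply: integrableD => //; last exact: (integrable_norm g0i).
  apply: integrable_sum => // i _; exact: (integrable_norm (fi i)).
(* The trajectory is known as a primitive only on [[0, T]]; [x i] agrees with it there and is given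
   by the integral formula everywhere. *)
pose x i s := X 0 i 0 + \int[mu]_(r in `[0, s]) f i r.
pose Q s := \sum_j \sum_i x i s * P s i j * x j s.
pose W s := Q s - \int[mu]_(r in `[0, s]) g0 r.
have xE t i : 0 <= t <= T -> x i t = X t i 0.
  by move=> tT; rewrite XF// /x restrE//; case/andP: tT.
have QE t : 0 <= t <= T -> Q t = qform (P t) (X t).
  move=> tT; rewrite /qform bilinear_formE; apply: eq_bigr => j _.
  by apply: eq_bigr => i _; rewrite !xE.
(* Off [N] all the primitives are differentiable with the expected derivative. The point 0 is put
   into [N] because two-sided derivatives are available only for [0 < t]. *)
pose N := ~` [set t : R | t != 0 /\ (forall i, lebesgue_pt (f i) t) /\ lebesgue_pt g0 t].
have N0 : mu.-negligible N.
  have ptae (h : R -> R) : mu.-integrable setT (EFin \o h) ->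
      {ae mu, forall t, lebesgue_pt h t}.
    move=> hi; apply: lebesgue_differentiation.
    by apply: open_integrable_locally => //; exact: openT.
  have n0ae : {ae mu, forall t : R, t != 0}.
    exists [set 0]; split; [exact: measurable_set1|exact: lebesgue_measure_set1|].
    by move=> t /= /negP; rewrite negbK => /eqP.
  have Fae := ae_filter_ringOfSetsType mu.
  have fae : {ae mu, forall t, forall i, lebesgue_pt (f i) t}.
    by apply: filter_forall => i; exact: ptae.
  by apply: filterS3 n0ae fae (ptae _ g0i) => t.
suff : W T <= W 0.
  have T01 : 0 <= T <= T by apply/andP; split; [exact: ltW|].
  have T00 : 0 <= (0 : R) <= T by apply/andP; split; [|exact: ltW].
  rewrite /W !QE// restrE// set_itv1 Rintegral_set1 subr0.
  by rewrite lerBlDr -lerBlDl.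
apply: (le_of_right_increments iH H0 N0 T0) => t tT.
- have /andP[t0 _] := tT.
  apply: cvgB; last exact: Rintegral_itv0_cvg_left.
  have xl i : x i s @[s --> t^'-] --> x i t.
    by apply: cvgD; [exact: cvg_cst|exact: Rintegral_itv0_cvg_left].
  apply: cvg_big => [|j _]; first exact: add_continuous.
  apply: cvg_big => [|i _]; first exact: add_continuous.
  by apply: cvgM => //; apply: cvgM => //; exact: has_deriv_on_cvg_left tT.
- move=> _; have /andP[t0 _] := tT.
  have xd i : right_dominated H t (x i).
    apply: right_dominatedD; first exact: right_dominated_cst.
    exact: right_dominated_primitive.
  have Pd i j : right_dominated H t (fun s => P s i j).
    exact: right_dominated_deriv H1.
  have gd : right_dominated H t (fun s => \int[mu]_(r in `[0, s]) g0 r).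
    exact: right_dominated_primitive.
  have [K K0 WK] : right_dominated H t W.
    apply: (right_dominatedB (f := Q) _ gd).
    apply: right_dominated_sum => j; apply: right_dominated_sum => i.
    by apply: right_dominatedM => //; exact: right_dominatedM.
  exists K; apply: filterS WK => s; apply: le_trans; exact: ler_norm.
- move=> /contrapT[tn0 [ft gt]].
  have t0 : 0 < t by rewrite lt_neqAle eq_sym tn0; case/andP: tT.
  have {}tT : 0 < t < T by rewrite t0; case/andP: tT.
  have tTc : 0 <= t <= T by case/andP: tT => *; rewrite !ltW.
  have patch0 (h : R -> R) : (h \_ `[0, T]) t = h t by rewrite patchE mem_set.
  have xd i : is_derive t 1 (x i) (F t i 0).
    rewrite -(patch0 (fun s => F s i 0)) -[X in is_derive _ _ _ X]add0r.
    by apply: is_deriveD; exact: Rintegral_itv0_is_derive.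
  have Pd i j : is_derive t 1 (fun s => P s i j) (dP t i j).
    exact: (has_deriv_on_is_derive (PdP i j)).
  have gd : is_derive t 1 (fun s => \int[mu]_(r in `[0, s]) g0 r) (g t).
    by rewrite -(patch0 g); exact: Rintegral_itv0_is_derive.
  (* Off [N] the derivative of [W] is the quadratic expression at [t] minus [g t], nonpositive by
     [Fg]. *)
  apply: is_derive_le0_right (is_deriveB (is_derive_quadratic xd Pd) gd) _.
  rewrite subr_le0 (_ : \col_i x i t = X t); first exact: Fg.
  by apply/colP => i; rewrite mxE xE.
Qed.

(** * The dissipation inequality *)

Lemma qformD (R : realType) (n : nat) (M N : 'M[R]_n) (u : 'cV[R]_n) :
  qform (M + N) u = qform M u + qform N u.
Proof. by rewrite /qform mulmxDr mulmxDl mxE. Qed.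

Lemma qform_sumZ (R : realType) (n m : nat) (lam : 'I_m -> R)
    (M : 'I_m -> 'M[R]_n) (u : 'cV[R]_n) :
  qform (\sum_i lam i *: M i) u = \sum_i lam i * qform (M i) u.
Proof.
rewrite /qform mulmx_sumr mulmx_suml summxE; apply: eq_bigr => i _.
by rewrite -scalemxAr -scalemxAl mxE.
Qed.

Lemma qform_congr (R : realType) (n p : nat) (M : 'M[R]_p) (N : 'M[R]_(p, n))
    (u : 'cV[R]_n) : qform (N^T *m M *m N) u = qform M (N *m u).
Proof. by rewrite /qform trmx_mul !mulmxA. Qed.

(** Testing the matrix at [(x, w)] turns its three summands into the derivative of the storage
    function along [f], the squared output and the weighted IQC integrands, since [Hv] maps [(x, w)]
    to [(v, w)]. *)
Lemma qform_lmi (R : realType) (nx nw nv ne m : nat)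
    (A : R -> 'M[R]_nx) (B : R -> 'M[R]_(nx, nw))
    (Cv : R -> 'M[R]_(nv, nx)) (Ce : R -> 'M[R]_(ne, nx))
    (Dvw : R -> 'M[R]_(nv, nw)) (Dew : R -> 'M[R]_(ne, nw))
    (vbar : R -> 'cV[R]_nv) (M : 'I_m -> 'M[R]_(nv + nw)) (lam : 'I_m -> R)
    (P dP : R -> 'M[R]_(nx + 1)) (t : R) (x : 'cV[R]_(nx + 1)) (w : 'cV[R]_nw) :
  let f := Aa A t *m x + Ba B t *m w in
  let e := Cea Ce t *m x + Dew t *m w in
  let v := Cva Cv vbar t *m x + Dvw t *m w in
  qform (lmi_mx A B Cv Ce Dvw Dew vbar P dP lam M t) (col_mx x w) =
    (f^T *m P t *m x + x^T *m dP t *m x + x^T *m P t *m f) 0 0 +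
    (e^T *m e) 0 0 + \sum_i lam i * qform (M i) (col_mx v w).
Proof.
move=> f e v; rewrite /lmi_mx !qformD qform_sumZ; congr (_ + _ + _).
- rewrite /qform tr_col_mx mul_row_block mul_row_col mulmx0 addr0.
  congr (fun_of_matrix _ 0 0); rewrite /f [(_ + _)^T]raddfD /= !trmx_mul.
  rewrite !(mulmxDl, mulmxDr) !mulmxA.
  (* The five terms on the left come in the order [dP], [A^T P], [P A], [B^T P], [P B]; the
     permutation groups those of [f^T P x] first. *)
  by rewrite [RHS]addrA [LHS](ACl (2*4*1*3*5)).
- by rewrite /qform -!mulmxA mul_row_col mulmxA -trmx_mul mul_row_col.
- apply: eq_bigr => i _; rewrite qform_congr /Hv mul_block_col mul0mx mul1mx.
  by rewrite add0r.
Qed.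

(** The product is dominated by the sum of the two squares, as [(|a| - |b|)^2 >= 0]. *)
Lemma L2sig_mul_integrable (R : realType) (n p : nat) (T : R)
    (u : R -> 'cV[R]_n) (v : R -> 'cV[R]_p) i j : L2sig T u -> L2sig T v ->
  (@lebesgue_measure R).-integrable `[0, T] (fun t => (u t i 0 * v t j 0)%:E).
Proof.
move=> /(_ i)[mu_ iu] /(_ j)[mv iv]; set mu := @lebesgue_measure R.
have sqr_int (h : R -> R) : measurable_fun (itv0 T) h ->
    (\int[mu]_(t in itv0 T) ((h t ^+ 2)%:E) < +oo)%E ->
    mu.-integrable `[0, T] (fun t => (h t ^+ 2)%:E).
  move=> mh ih; apply/integrableP; split.
    by apply/measurable_EFinP; exact: measurable_funX.
  by under eq_integral do rewrite gee0_abs ?lee_fin ?sqr_ge0//.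
apply: (le_integrable _ _ _ (integrableD _ (sqr_int _ mu_ iu) (sqr_int _ mv iv))) => //.
  by apply/measurable_EFinP; exact: measurable_funM.
move=> t _; rewrite /= lee_fin normrM.
rewrite [leRHS]ger0_norm ?addr_ge0 ?sqr_ge0//.
rewrite -(real_normK (num_real (u t i 0))) -(real_normK (num_real (v t j 0))).
have := sqr_ge0 (`|u t i 0| - `|v t j 0|).
have := normr_ge0 (u t i 0); have := normr_ge0 (v t j 0).
nra.
Qed.

Lemma L2sig_qform_integrable (R : realType) (n : nat) (T : R)
    (u : R -> 'cV[R]_n) (M : 'M[R]_n) : L2sig T u ->
  (@lebesgue_measure R).-integrable `[0, T] (EFin \o (fun t => qform M (u t))).
Proof.
move=> u2; have -> : EFin \o (fun t => qform M (u t)) =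
    (fun t => \sum_j \sum_i (M i j)%:E * (u t i 0 * u t j 0)%:E)%E.
  apply/funext => t; rewrite /= /qform bilinear_formE -sumEFin.
  apply: eq_bigr => j _; rewrite -sumEFin; apply: eq_bigr => i _.
  by rewrite -EFinM mulrAC mulrC.
apply: integrable_sum => // j _; apply: integrable_sum => // i _.
by apply: integrableZl => //; exact: L2sig_mul_integrable.
Qed.

Lemma L2sig_col_mx (R : realType) (n p : nat) (T : R)
    (u : R -> 'cV[R]_n) (v : R -> 'cV[R]_p) :
  L2sig T u -> L2sig T v -> L2sig T (fun t => col_mx (u t) (v t)).
Proof.
move=> u2 v2 i; case: (split_ordP i) => j ->.
  rewrite (_ : (fun t => _) = (fun t => u t j 0)); last first.
    by apply/funext => t; rewrite col_mxEu.
  by under eq_integral do rewrite col_mxEu; exact: u2.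
rewrite (_ : (fun t => _) = (fun t => v t j 0)); last first.
  by apply/funext => t; rewrite col_mxEd.
by under eq_integral do rewrite col_mxEd; exact: v2.
Qed.

Lemma Rintegral_sum_ge0 (R : realType) (D : set R) (n : nat) (f : 'I_n -> R -> R) :
  measurable D ->
  (forall i, (@lebesgue_measure R).-integrable D (EFin \o f i)) ->
  (forall i, 0 <= \int[@lebesgue_measure R]_(t in D) f i t) ->
  0 <= \int[@lebesgue_measure R]_(t in D) \sum_i f i t.
Proof.
move=> mD; elim: n f => [|n ih] f fi f0.
  by apply: Rintegral_ge0 => t _; rewrite big_ord0.
under eq_Rintegral do rewrite big_ord_recl.
rewrite RintegralD//; first by rewrite addr_ge0// ih.
rewrite (_ : EFin \o _ = fun t => \sum_i (f (lift ord0 i) t)%:E)%E.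
  by apply: integrable_sum => // i _; exact: fi.
by apply/funext => t; rewrite /= -sumEFin.
Qed.

Theorem theorem1 (R : realType) (nx nw nv ne m : nat) (T : R)
    (A : R -> 'M[R]_nx) (B : R -> 'M[R]_(nx, nw))
    (Cv : R -> 'M[R]_(nv, nx)) (Ce : R -> 'M[R]_(ne, nx))
    (Dvw : R -> 'M[R]_(nv, nw)) (Dew : R -> 'M[R]_(ne, nw))
    (vbar : R -> 'cV[R]_nv)
    (Dset : set ((R -> 'cV[R]_nv) -> (R -> 'cV[R]_nw)))
    (M : 'I_m -> 'M[R]_(nv + nw)) (lam : 'I_m -> R)
    (P dP : R -> 'M[R]_(nx + 1)) :
  0 < T ->
  (forall Delta, Dset Delta -> causal_operator T Delta) ->
  well_posed A B Cv Ce Dvw Dew vbar T Dset ->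
  (forall i, symmetric_mx (M i)) ->
  (forall Delta, Dset Delta -> forall i, satisfies_IQC T (M i) Delta) ->
  (forall i, 0 <= lam i) ->
  (forall t, 0 <= t <= T -> symmetric_mx (P t)) ->
  mx_has_deriv_on T P dP ->
  psd (P T) ->
  (forall t, 0 <= t <= T ->
     negdef (lmi_mx A B Cv Ce Dvw Dew vbar P dP lam M t)) ->
  forall Delta, Dset Delta ->
  forall xa v w de, is_solution A B Cv Ce Dvw Dew vbar T Delta xa v w de ->
    l2norm T de <= Num.sqrt (qform (P 0) (xa0 R nx)).
Proof.
move=> T0 _ _ _ iqc lam0 _ PdP PT lmi Delta DD xa v w de.
move=> [[_ v2 w2 de2] [x0 [xE [vE [eE wE]]]]].
set mu := @lebesgue_measure R.
pose q i t := qform (M i) (col_mx (v t) (w t)).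
pose n2 t := ((de t)^T *m de t) 0 0.
pose sq t := \sum_i lam i * q i t.
have qi i : mu.-integrable `[0, T] (EFin \o q i).
  exact: (L2sig_qform_integrable (M i) (L2sig_col_mx v2 w2)).
have lqi i : mu.-integrable `[0, T] (EFin \o (fun t => lam i * q i t)).
  exact: (@integrableZl _ _ _ mu _ _ (lam i) _ (qi i)).
have sqi : mu.-integrable `[0, T] (EFin \o sq).
  rewrite (_ : EFin \o sq = fun t => \sum_i (lam i * q i t)%:E)%E.
    by apply: integrable_sum => // i _; exact: lqi.
  by apply/funext => t; rewrite /= -sumEFin.
have n2i : mu.-integrable `[0, T] (EFin \o n2).
  have := L2sig_qform_integrable 1%:M de2; rewrite /qform.
  by rewrite (_ : (fun t => _) = n2)//; apply/funext => t; rewrite mulmx1.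
(* Each IQC is weighted by [lam i >= 0]. The IQC concerns [Delta v], which equals [w] on [[0, T]],
   enough for the integrals to coincide. *)
have sq0 : 0 <= \int[mu]_(t in `[0, T]) sq t.
  apply: Rintegral_sum_ge0 => // i; rewrite RintegralZl// mulr_ge0//.
  have := iqc Delta DD i v v2; rewrite /itv0 (_ : Rintegral _ _ _ =
    \int[mu]_(t in `[0, T]) q i t)//.
  by apply: eq_Rintegral => t; rewrite inE/= in_itv/= => tT; rewrite /q wE.
(* [Num.sqrt] is monotone on all reals, being 0 on negative ones, so comparing radicands
   suffices. *)
apply: ler_wsqrtr; change (\int[mu]_(t in `[0, T]) n2 t <= qform (P 0) (xa0 R nx)).
have nsi : mu.-integrable `[0, T] (EFin \o (fun t => n2 t + sq t)).
  rewrite (_ : EFin \o _ = (EFin \o n2) \+ (EFin \o sq))%E//.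
  exact: integrableD.
have gi : mu.-integrable `[0, T] (EFin \o (fun t => - (n2 t + sq t))).
  by apply: (@integrableN _ _ _ mu _ (EFin \o (fun t => n2 t + sq t))).
have := @qform_growth R _ T xa (fun t => Aa A t *m xa t + Ba B t *m w t) P dP
  (fun t => - (n2 t + sq t)) T0.
have -> : \int[mu]_(t in `[0, T]) - (n2 t + sq t) =
    - (\int[mu]_(t in `[0, T]) n2 t + \int[mu]_(t in `[0, T]) sq t).
  rewrite -RintegralD// -mulN1r -RintegralZl//.
  by apply: eq_Rintegral => t _; rewrite mulN1r.
have {}PT := PT (xa T).
rewrite x0 => growth.
suff : qform (P T) (xa T) - qform (P 0) (xa0 R nx) <=
    - (\int[mu]_(t in `[0, T]) n2 t + \int[mu]_(t in `[0, T]) sq t) by lra.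
apply: growth => //.
- by move=> i; case: (xE i).
- by move=> i t tT; case: (xE i) => _ ->.
- move=> t tT.
  have : qform (lmi_mx A B Cv Ce Dvw Dew vbar P dP lam M t)
      (col_mx (xa t) (w t)) <= 0.
    (* [negdef] speaks only of nonzero vectors; at zero the form vanishes, so the weak inequality
       holds at every [t] in [[0, T]]. *)
    have [->|nz] := eqVneq (col_mx (xa t) (w t)) 0.
      by rewrite /qform mulmx0 mxE.
    exact/ltW/lmi.
  rewrite qform_lmi -vE// -eE// => h.
  by rewrite -subr_le0 opprK addrA.
Qed.
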